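(* Let $G$ be any $\Delta$-regular graph with order $n$. Then $A(G;x)$ has (exactly) $\Delta+1$ non-zero coefficients. Furthermore, $$A(G;x)=\sum_{i=0}^{\Delta}A_{\Delta-2i}(G)\,x^{n+\Delta-2i},$$ with $A_{-\Delta}(G)=n$, $A_{\Delta}(G)\ge 1$, and, if $\Delta>0$, $$A_{\Delta-2i}(G)\ge\frac{n\binom{\Delta}{i}}{\min\{\Delta,n-i\}}\qquad\text{for } 1\le i\le\Delta-1.$$
   Context: Graphs are finite, simple, nonempty, and not necessarily connected; the order is the number of vertices. For a graph $G=(V,E)$ with order $n$ and maximum degree $\Delta$, and $X\subseteq V$, $\delta_X(v)$ is the number of neighbours of $v$ in $X$, $\overline{X}=V\setminus X$, and $\langle X\rangle$ is the induced subgraph. $G$ is $\Delta$-regular if all its vertices have degree $\Delta$. For a nonempty $S\subseteq V$ with $\langle S\rangle$ connected, and an integer $k\in[-\Delta,\Delta]$, $S$ is a defensive $k$-alliance if $\delta_S(v)\ge\delta_{\overline S}(v)+k$ for every $v\in S$; the exact index of alliance of $S$ is $k_S=\max\{k\in[-\Delta,\Delta]\cap\mathbb Z: S\text{ is a defensive }k\text{-alliance}\}=\min_{v\in S}\{\delta_S(v)-\delta_{\overline S}(v)\}$, and $S$ is called an exact defensive $k_S$-alliance. $A_k(G)$ denotes the number of exact defensive $k$-alliances in $G$ (subsets $S\subseteq V$), and the alliance polynomial of $G$ is $A(G;x)=\sum_{k=-\Delta}^{\Delta}A_k(G)\,x^{n+k}$. *)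

(* Defs.v *)
(* A finite simple graph is given by its adjacency
   relation e : rel T on a finType T; symmetry, irreflexivity and
   nonemptiness of T are hypotheses of the theorem. *)
From HB Require Import structures.
From mathcomp Require Import all_boot all_order all_algebra.

Set Implicit Arguments.
Unset Strict Implicit.
Unset Printing Implicit Defensive.

Import Order.TTheory GRing.Theory Num.Theory.
Local Open Scope ring_scope.

Definition nbrs_in (T : finType) (e : rel T) (X : {set T}) (v : T) : nat :=
  #|[set u in X | e v u]|.

Definition degree (T : finType) (e : rel T) (v : T) : nat :=
  nbrs_in e [set: T] v.

Definition max_degree (T : finType) (e : rel T) : nat :=
  (\max_(v : T) degree e v)%N.

Definition regular_graph (T : finType) (e : rel T) (d : nat) : Prop :=
  forall v : T, degree e v = d.

Definition induced_rel (T : finType) (e : rel T) (S : {set T}) : rel T :=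
  [rel u w | [&& u \in S, w \in S & e u w]].

Definition induced_connected (T : finType) (e : rel T) (S : {set T}) : bool :=
  [forall u in S, forall w in S, connect (induced_rel e S) u w].

Definition defensive_alliance (T : finType) (e : rel T) (k : int)
    (S : {set T}) : bool :=
  [&& - (max_degree e)%:Z <= k <= (max_degree e)%:Z,
      S != set0,
      induced_connected e S &
      [forall v in S, (nbrs_in e (~: S) v)%:Z + k <= (nbrs_in e S v)%:Z]].

(* As j ranges over 'I_(2 * d + 1), [offset d j] ranges over the integers of
   the interval [-d, d]. *)
Definition offset (d : nat) (j : 'I_(2 * d).+1) : int := (j : nat)%:Z - d%:Z.

(* [k] is the largest index in the interval [-Delta, Delta] for which [S] is a
   defensive alliance; quantifying over 'I_(2 * Delta + 1) makes this boolean,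
   see [exact_allianceP]. *)
Definition exact_alliance (T : finType) (e : rel T) (k : int)
    (S : {set T}) : bool :=
  defensive_alliance e k S &&
  [forall j : 'I_(2 * max_degree e).+1,
     defensive_alliance e (offset j) S ==> (offset j <= k)].

Definition num_exact (T : finType) (e : rel T) (k : int) : nat :=
  #|[set S : {set T} | exact_alliance e k S]|.

(* The exponent n + k is nonnegative whenever k >= -Delta, since Delta < n in a
   nonempty simple graph (see [alliance_expE]); the absolute value only casts
   it to nat. *)
Definition alliance_exp (T : finType) (k : int) : nat := `|(#|T|%:Z + k)%R|%N.

Definition alliance_poly (T : finType) (e : rel T) : {poly int} :=
  \sum_(j < (2 * max_degree e).+1)
     (num_exact e (offset j))%:Z *: 'X^(alliance_exp T (offset j)).

Lemma offset_surj (d : nat) (k : int) :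
  - d%:Z <= k <= d%:Z -> exists j : 'I_(2 * d).+1, offset j = k.
Proof.
move=> /andP[lo hi].
have k0 : 0 <= k + d%:Z by rewrite -lerBlDr sub0r.
have jP : (`|(k + d%:Z)%R|%N < (2 * d).+1)%N.
  by rewrite ltnS -lez_nat gez0_abs // mul2n -addnn PoszD lerD2r.
by exists (Ordinal jP); rewrite /offset /= gez0_abs // addrK.
Qed.

Lemma exact_allianceP (T : finType) (e : rel T) (k : int) (S : {set T}) :
  reflect (defensive_alliance e k S /\
           forall k' : int, defensive_alliance e k' S -> k' <= k)
          (exact_alliance e k S).
Proof.
apply: (iffP andP) => [[Sk /forallP maxk] | [Sk maxk]]; split=> //.
  move=> k' Sk'; have /andP[/offset_surj[j jk'] _] := Sk'.
  by have := maxk j; rewrite jk' Sk'.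
by apply/forallP => j; apply/implyP; apply: maxk.
Qed.

Lemma max_degree_lt (T : finType) (e : rel T) :
  irreflexive e -> (0 < #|T|)%N -> (max_degree e < #|T|)%N.
Proof.
move=> irr T0; rewrite -(prednK T0) ltnS; apply/bigmax_leqP => v _.
rewrite -ltnS (prednK T0) -cardsT; apply/proper_card/properP.
by split; [apply/subsetT | exists v; rewrite ?inE ?irr].
Qed.

Lemma alliance_expE (T : finType) (e : rel T) (k : int) :
  irreflexive e -> (0 < #|T|)%N -> - (max_degree e)%:Z <= k ->
  (alliance_exp T k)%:Z = #|T|%:Z + k.
Proof.
move=> irr T0 kD; apply: gez0_abs; rewrite addrC -lerBlDr sub0r.
by apply: le_trans kD; rewrite lerN2 lez_nat ltnW // max_degree_lt.
Qed.

(* Main.v *)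
(* In a D-regular graph the exact index of a nonempty connected set S is
   D - 2i, where i is the largest number of neighbours that a vertex of S has
   outside S.  Given a vertex v and a set X of i neighbours of v, let S be the
   connected component of v in G - X.  All edges leaving S end in X, so every
   vertex of S has at most i neighbours outside S, while v has exactly i: hence
   S has exact index D - 2i.  There are n * 'C(D, i) such pairs (v, X).  The set
   X is recovered from S as its outer boundary, and v is both outside X and
   adjacent to every vertex of X; so at most min(D, n - i) pairs yield the same
   S. *)
Require Import Defs.
From HB Require Import structures.
From mathcomp Require Import all_boot all_order all_algebra.
From mathcomp Require Import zify.

Set Implicit Arguments.
Unset Strict Implicit.
Unset Printing Implicit Defensive.

Import Order.TTheory GRing.Theory Num.Theory.
Local Open Scope ring_scope.

(** * Sums supported on even indices, and non-zero coefficients of polynomials *)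

Lemma big_nat_even (V : nmodType) (F : nat -> V) (n : nat) :
  (forall j, odd j -> F j = 0) ->
  \sum_(0 <= j < (2 * n).+1) F j = \sum_(0 <= i < n.+1) F (2 * i)%N.
Proof.
move=> F0; elim: n => [|n IHn]; first by rewrite muln0 !big_nat1.
rewrite mulnS big_nat_recr //= big_nat_recr //= IHn [RHS]big_nat_recr //=.
by rewrite (F0 (2 * n).+1) ?addr0 ?mulnS //= mul2n odd_double.
Qed.

(** Distinct exponents rule out cancellation, so the indices of the non-zero coefficients are
    exactly the values of [f] below [N]. *)
Lemma count_nz_sum_monomials (R : nzRingType) (N : nat) (c : nat -> R)
    (f : nat -> nat) :
  (forall i, (i < N)%N -> c i != 0) ->
  {in gtn N &, injective f} ->
  count (fun a => a != 0) (\sum_(0 <= i < N) c i *: 'X^(f i) : {poly R}) = N.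
Proof.
move=> c_nz f_inj; set p := \sum_(0 <= i < N) _.
have coef_f i : (i < N)%N -> p`_(f i) = c i.
  move=> iN; rewrite coef_sum (bigD1_seq i) ?mem_index_iota ?iota_uniq //=.
  rewrite coefZ coefXn eqxx mulr1 big_seq_cond big1 ?addr0 // => j.
  rewrite mem_index_iota /= => /andP[jN ji]; rewrite coefZ coefXn.
  case: eqP => [/f_inj ij|_]; last by rewrite mulr0.
  by rewrite ij ?eqxx in ji.
have coef_nz k : (p`_k != 0) = (k \in map f (iota 0 N)).
  apply/idP/mapP => [pk|[i]]; last first.
    by rewrite mem_iota => /= iN ->; rewrite coef_f // c_nz.
  have [/hasP[i iN /eqP->]|/hasPn nf] :=
      boolP (has (fun i => k == f i) (iota 0 N)).
    by exists i.
  case/negP: pk; rewrite coef_sum big_seq big1 // => i.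
  rewrite /index_iota subn0 => /nf/negPf kf; by rewrite coefZ coefXn kf mulr0.
(* Count indices instead of entries: those with a non-zero entry form a permutation of the list of
   exponents. *)
rewrite -[X in count _ X](mkseq_nth 0) count_map -size_filter.
transitivity (size (map f (iota 0 N))); last by rewrite size_map size_iota.
apply/perm_size/uniq_perm.
- by rewrite filter_uniq ?iota_uniq.
- rewrite map_inj_in_uniq ?iota_uniq // => i j.
  by rewrite !mem_iota => iN jN; apply: f_inj.
move=> k; rewrite mem_filter /= mem_iota /= coef_nz andb_idr // -coef_nz.
(* Beyond the size of [p] the default value 0 is read, so a non-zero coefficient has its index in
   range. *)
by apply: contraR; rewrite -leqNgt => /(nth_default 0)->.
Qed.

(** * Components after deletion of a vertex set *)

Lemma induced_relE (T : finType) (e : rel T) (S : {set T}) (u w : T) :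
  induced_rel e S u w = [&& u \in S, w \in S & e u w].
Proof. by []. Qed.

(** For [v] outside [X] this is the component of [v] in G - X; for [v] in [X] it degenerates to the
    singleton of [v]. *)
Definition component (T : finType) (e : rel T) (X : {set T}) (v : T) : {set T} :=
  [set u | connect (induced_rel e (~: X)) v u].

Definition exposure (T : finType) (e : rel T) (S : {set T}) : nat :=
  (\max_(v in S) nbrs_in e (~: S) v)%N.

Section Component.
Variables (T : finType) (e : rel T) (X : {set T}) (v : T).
Hypothesis e_sym : symmetric e.

Lemma mem_component : v \in component e X v.
Proof. by rewrite inE connect0. Qed.

Lemma component_notin u : v \notin X -> u \in component e X v -> u \notin X.
Proof.
rewrite inE => vX /connectP[p + ->]; case/lastP: p => //= p w.
by rewrite rcons_path last_rcons => /andP[_] /and3P[_ + _]; rewrite inE.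
Qed.

Lemma component_boundary u w : v \notin X ->
  u \in component e X v -> w \notin component e X v -> e u w -> w \in X.
Proof.
move=> vX uC; have uX := component_notin vX uC => + uw.
apply: contraNT => wX; move: uC; rewrite !inE => vu; apply: connect_trans vu (connect1 _).
by rewrite induced_relE !inE uX wX.
Qed.

(** Every prefix of a path from [v] in G - X ends in the component, so the whole path runs inside
    it; two vertices are then joined through [v]. *)
Lemma induced_connected_component : induced_connected e (component e X v).
Proof.
set C := component e X v.
have C_sym : connect_sym (induced_rel e C).
  by apply: sym_connect_sym => x y; rewrite !induced_relE e_sym andbCA.
have toC u : u \in C -> connect (induced_rel e C) v u.
  rewrite inE => /connectP[p + ->].
  elim/last_ind: p => [//|p w IHp]; rewrite rcons_path last_rcons.
  move=> /andP[vp pw]; apply: connect_trans (IHp vp) (connect1 _).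
  have lC : last v p \in C by rewrite inE; apply/connectP; exists p.
  rewrite induced_relE lC inE; move: (lC); rewrite inE => vl.
  by rewrite (connect_trans vl (connect1 pw)); case/and3P: pw.
apply/forall_inP => u uC; apply/forall_inP => w wC.
by apply: connect_trans (toC w wC); rewrite C_sym toC.
Qed.

End Component.

(** * Exact indices in regular graphs *)

Section Regular.
Variables (T : finType) (e : rel T) (D : nat).
Hypotheses (e_sym : symmetric e) (e_irr : irreflexive e).
Hypothesis T_gt0 : (0 < #|T|)%N.
Hypothesis e_reg : regular_graph e D.

Lemma max_degree_regular : max_degree e = D.
Proof.
have /card_gt0P[v _] := T_gt0; rewrite /max_degree (eq_bigr (fun=> D)) //.
apply/eqP; rewrite eqn_leq (leq_bigmax v) andbT.
by apply/bigmax_leqP.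
Qed.

Lemma card_nbrs v : #|[set u | e v u]| = D.
Proof. by rewrite -(e_reg v) /degree /nbrs_in; apply: eq_card => u; rewrite !inE. Qed.

Lemma nbrs_inC (S : {set T}) v : (nbrs_in e S v + nbrs_in e (~: S) v)%N = D.
Proof.
rewrite -(card_nbrs v) -(cardsID S); congr (_ + _)%N; apply: eq_card => u.
  by rewrite !inE andbC.
by rewrite !inE.
Qed.

Lemma nbrs_in_le (S : {set T}) v : (nbrs_in e S v <= D)%N.
Proof. by rewrite -(nbrs_inC S v) leq_addr. Qed.

Lemma exposure_le (S : {set T}) : (exposure e S <= D)%N.
Proof. by apply/bigmax_leqP => v _; apply: nbrs_in_le. Qed.

(** By regularity the condition at [v] reads k <= D - 2 [nbrs_in e (~: S) v]; it is tightest at a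
    vertex attaining the exposure. *)
Lemma defensive_alliance_regular k (S : {set T}) :
  defensive_alliance e k S =
  [&& - D%:Z <= k, S != set0, induced_connected e S
    & k <= D%:Z - (2 * exposure e S)%:Z].
Proof.
rewrite /defensive_alliance max_degree_regular.
have [->|[x xS]] := set_0Vmem S; first by rewrite eqxx !andbF.
case: (- D%:Z <= k) => //=; case: (S != set0); rewrite ?andbF //=.
case: (induced_connected e S); rewrite ?andbF //=.
apply/andP/idP => [[_ /forall_inP kS]|kS].
  have [|v vS vE] := @eq_bigmax_cond _ (mem S) (nbrs_in e (~: S)).
    by apply/card_gt0P; exists x.
  by rewrite /exposure vE; have := kS v vS; have := nbrs_inC S v; lia.
split; first by lia.
apply/forall_inP => v vS; have := nbrs_inC S v.
have : (nbrs_in e (~: S) v <= exposure e S)%N.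
  exact: leq_bigmax_cond.
by lia.
Qed.

Lemma exact_alliance_regular k (S : {set T}) :
  exact_alliance e k S =
  [&& S != set0, induced_connected e S & k == D%:Z - (2 * exposure e S)%:Z].
Proof.
have S_le := exposure_le S.
apply/exact_allianceP/and3P => [[]|[S0 Sc /eqP->]].
  rewrite defensive_alliance_regular => /and4P[Dk S0 Sc kS] kmax; split=> //.
  (* The value D - 2 [exposure e S] is itself admissible: exposure at most D keeps it at least
     -D. *)
  rewrite eq_le kS kmax // defensive_alliance_regular S0 Sc lexx.
  by lia.
split; first by rewrite defensive_alliance_regular S0 Sc lexx; lia.
by move=> k'; rewrite defensive_alliance_regular => /and4P[].
Qed.

(** An exact index k satisfies k + D = 2 (D - [exposure e S]), which is even. *)
Lemma num_exact_odd (k : int) : odd `|(k + D%:Z)%R|%N -> num_exact e k = 0%N.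
Proof.
move=> oddk; apply/eqP; rewrite cards_eq0; apply/eqP/setP => S.
rewrite !inE exact_alliance_regular; apply/negP => /and3P[_ _ /eqP kE].
by move: oddk; rewrite kE; have := exposure_le S; lia.
Qed.

(** * Components as exact alliances *)

Lemma exposure_component v (X : {set T}) :
  X \subset [set u | e v u] -> exposure e (component e X v) = #|X|.
Proof.
move=> XN; have vX : v \notin X.
  by apply/negP => /(subsetP XN); rewrite inE e_irr.
apply/eqP; rewrite eqn_leq; apply/andP; split.
  apply/bigmax_leqP => u uC; apply/subset_leq_card/subsetP => w.
  by rewrite inE inE => /andP[wC]; apply: component_boundary wC.
(* The vertex [v] attains the maximum, since all of [X] consists of its neighbours outside the
   component. *)
apply: leq_trans (leq_bigmax_cond _ (mem_component e X v)).
apply/subset_leq_card/subsetP => w wX; have := subsetP XN w wX.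
rewrite inE => vw; rewrite inE in_setC vw andbT.
by apply: contraL wX; apply: component_notin.
Qed.

Lemma exact_component v (X : {set T}) :
  X \subset [set u | e v u] ->
  exact_alliance e (D%:Z - (2 * #|X|)%:Z) (component e X v).
Proof.
move=> XN; rewrite exact_alliance_regular exposure_component // eqxx andbT.
rewrite induced_connected_component // andbT.
by apply/set0Pn; exists v; apply: mem_component.
Qed.

(** A vertex of [X] is adjacent to [v] and lies outside the common component, so it is the end of an
    edge leaving the component of [w], hence is in [Y]. Exchanging the roles gives equality. *)
Lemma component_inj v w (X Y : {set T}) :
  X \subset [set u | e v u] -> Y \subset [set u | e w u] ->
  component e X v = component e Y w -> X \subset Y.
Proof.
move=> XN YN XY; have vX : v \notin X.
  by apply/negP => /(subsetP XN); rewrite inE e_irr.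
have wY : w \notin Y by apply/negP => /(subsetP YN); rewrite inE e_irr.
apply/subsetP => x xX; apply: (@component_boundary _ e Y w v x) => //.
- by rewrite -XY mem_component.
- by rewrite -XY; apply: contraL xX; apply: component_notin.
- by have := subsetP XN x xX; rewrite inE.
Qed.

Lemma num_exact_gt0 i : (i <= D)%N -> (0 < num_exact e (D%:Z - (2 * i)%:Z))%N.
Proof.
move=> iD; have /card_gt0P[v _] := T_gt0.
have : (0 < #|[set X : {set T} | X \subset [set u | e v u] & #|X| == i]|)%N.
  by rewrite cards_draws card_nbrs bin_gt0.
case/card_gt0P=> X; rewrite inE => /andP[XN /eqP Xi]; apply/card_gt0P.
by exists (component e X v); rewrite inE -Xi exact_component.
Qed.

(** * Double counting of pairs (v, X) *)

Definition pointed_nbr_sets i : {set T * {set T}} :=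
  [set p : T * {set T} | (p.2 \subset [set u | e p.1 u]) && (#|p.2| == i)].

Lemma card_pointed_nbr_sets i :
  #|pointed_nbr_sets i| = (#|T| * 'C(D, i))%N.
Proof.
(* The added [true &&] gives the predicate the shape required by [pair_big_dep]. *)
rewrite -sum1_card.
rewrite (eq_bigl (fun p : T * {set T} =>
           true && ((p.2 \subset [set u | e p.1 u]) && (#|p.2| == i)))).
  rewrite -(pair_big_dep xpredT (fun v (X : {set T}) =>
              (X \subset [set u | e v u]) && (#|X| == i)) (fun _ _ => 1%N)) /=.
  rewrite (eq_bigr (fun=> 'C(D, i))) ?sum_nat_const //= => v _.
  rewrite sum1_card -(card_nbrs v) -cards_draws.
  by apply: eq_card => X; rewrite !inE.
by move=> p; rewrite !inE.
Qed.

Lemma card_component_fibre i (S : {set T}) : (0 < i)%N ->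
  (#|[set p in pointed_nbr_sets i | component e p.2 p.1 == S]|
     <= minn D (#|T| - i))%N.
Proof.
move=> i0; set F := [set p in _ | _].
have [->|[[v X] vXF]] := set_0Vmem F; first by rewrite cards0.
have snd_F p : p \in F -> p.2 = X.
  move: vXF; rewrite !inE /= => /andP[/andP[XN _] /eqP vS].
  move=> /andP[/andP[pN _] /eqP pS]; apply/eqP; rewrite eqEsubset.
  by rewrite (component_inj pN XN) ?(component_inj XN pN) ?vS ?pS.
have fst_inj : {in F &, injective fst}.
  by move=> [a A] [b B] /snd_F/= -> /snd_F/= -> /= ->.
have [Xi] : #|X| = i by move: vXF; rewrite !inE => /andP[/andP[_ /eqP]].
(* Here i > 0 matters: all first components in the fibre are neighbours of one fixed [x] in [X],
   which gives the bound D. *)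
have /card_gt0P[x xX] : (0 < #|X|)%N by rewrite Xi.
rewrite -(card_in_imset fst_inj) leq_min; apply/andP; split.
  rewrite -(card_nbrs x); apply/subset_leq_card/subsetP => _ /imsetP[p pF ->].
  have := snd_F p pF; move: pF; rewrite !inE e_sym => /andP[/andP[pN _] _] pX.
  by have := subsetP pN x; rewrite pX inE; apply.
(* The bound n - i is the size of the complement of [X], which contains all first components. *)
rewrite -Xi -(cardsC X) addKn.
apply/subset_leq_card/subsetP => _ /imsetP[p pF ->].
have := snd_F p pF; move: pF; rewrite !inE => /andP[/andP[pN _] _] <-.
by apply/negP => /(subsetP pN); rewrite inE e_irr.
Qed.

Lemma num_exact_lower_bound i : (0 < i)%N ->
  (#|T| * 'C(D, i) <= num_exact e (D%:Z - (2 * i)%:Z) * minn D (#|T| - i))%N.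
Proof.
move=> i0; rewrite -card_pointed_nbr_sets -sum1_card.
rewrite (partition_big (fun p => component e p.2 p.1)
           (mem [set S | exact_alliance e (D%:Z - (2 * i)%:Z) S])) /=; last first.
  by move=> [v X]; rewrite !inE /= => /andP[XN /eqP<-]; apply: exact_component.
rewrite -sum_nat_const; apply: leq_sum => S _.
apply: leq_trans (card_component_fibre S i0); rewrite sum1_card.
by apply: eq_leq; apply: eq_card => p; rewrite [RHS]inE.
Qed.

(** * Minimal index and the polynomial *)

(** Exposure D means that some vertex of [S] has no neighbour in [S]; connectedness then leaves only
    that vertex. *)
Lemma exact_alliance_min (S : {set T}) :
  exact_alliance e (- D%:Z) S = (S \in [set [set v] | v : T]).
Proof.
rewrite exact_alliance_regular; apply/and3P/imsetP => [[S0 Sc /eqP SE]|[v _ ->]].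
  have {}SE : exposure e S = D by lia.
  have [|v vS vE] := @eq_bigmax_cond _ (mem S) (nbrs_in e (~: S)).
    by rewrite card_gt0.
  have v0 : nbrs_in e S v = 0%N.
    by have := nbrs_inC S v; rewrite -vE -/(exposure e S) SE; lia.
  exists v => //; apply/eqP; rewrite eqEsubset sub1set vS andbT.
  apply/subsetP => u uS; rewrite inE.
  (* The first edge of a nonempty path from [v] would give [v] a neighbour in [S]. *)
  have /forall_inP/(_ v vS)/forall_inP/(_ u uS)/connectP[[|w p]] := Sc.
    by move=> _ /= ->.
  move=> /= /andP[/and3P[_ wS vw] _] _.
  by move/eqP: v0; rewrite cards_eq0 => /eqP/setP/(_ w); rewrite !inE wS vw.
split.
- by apply/set0Pn; exists v; rewrite inE.
- by apply/forall_inP => u /set1P->; apply/forall_inP => w /set1P->.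
rewrite /exposure big_set1; have := nbrs_inC [set v] v.
have -> : nbrs_in e [set v] v = 0%N.
  apply/eqP; rewrite cards_eq0; apply/eqP/setP => u; rewrite !inE.
  by case: eqP => // ->; rewrite e_irr.
by rewrite add0n => ->; lia.
Qed.

Lemma alliance_poly_regular :
  alliance_poly e =
    \sum_(0 <= i < D.+1)
       (num_exact e (D%:Z - (2 * i)%:Z))%:Z
         *: 'X^(alliance_exp T (D%:Z - (2 * i)%:Z)).
Proof.
pose F j : {poly int} :=
  (num_exact e (j%:Z - D%:Z))%:Z *: 'X^(alliance_exp T (j%:Z - D%:Z)).
have -> : alliance_poly e = \sum_(0 <= j < (2 * D).+1) F j.
  by rewrite /alliance_poly max_degree_regular big_mkord.
rewrite big_nat_even => [|j oddj]; last first.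
  by rewrite /F num_exact_odd ?scale0r // subrK.
(* Offsets increase from -D while the target indices decrease from D, hence the reversal. *)
rewrite big_nat_rev; apply: eq_big_nat => i /andP[_ iD].
by rewrite /F (_ : (2 * (0 + D.+1 - i.+1))%:Z - D%:Z = D%:Z - (2 * i)%:Z) //; lia.
Qed.

End Regular.

Theorem theorem2p9 (T : finType) (e : rel T) (D : nat)
    (e_sym : symmetric e) (e_irr : irreflexive e) (T_gt0 : (0 < #|T|)%N)
    (e_reg : regular_graph e D) :
  [/\ count (fun c : int => c != 0) (alliance_poly e) = D.+1,
      alliance_poly e =
        \sum_(0 <= i < D.+1)
           (num_exact e (D%:Z - (2 * i)%:Z))%:Z
             *: 'X^(alliance_exp T (D%:Z - (2 * i)%:Z)),
      num_exact e (- D%:Z) = #|T|,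
      (1 <= num_exact e D%:Z)%N
    & (0 < D)%N -> forall i : nat, (1 <= i <= D - 1)%N ->
        (#|T| * 'C(D, i))%:R / (minn D (#|T| - i))%:R
          <= (num_exact e (D%:Z - (2 * i)%:Z))%:R :> rat].
Proof.
(* This makes the exponents n + D - 2i positive, so the absolute value keeps them distinct, and
   makes the denominator min(D, n - i) positive. *)
have D_lt : (D < #|T|)%N.
  by rewrite -(max_degree_regular T_gt0 e_reg) max_degree_lt.
split.
- rewrite (alliance_poly_regular T_gt0 e_reg).
  apply: (@count_nz_sum_monomials int) => [i iD|i j iD jD].
    by rewrite eqz_nat -lt0n num_exact_gt0.
  by rewrite /alliance_exp !inE in iD jD *; lia.
- exact: alliance_poly_regular.
- rewrite -[RHS](card_imset _ (@set1_inj T)); apply: eq_card => S.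
  by rewrite inE (exact_alliance_min e_irr T_gt0 e_reg).
- have := num_exact_gt0 e_sym e_irr T_gt0 e_reg (leq0n D).
  by rewrite muln0 subr0.
move=> D0 i /andP[i0 iD].
rewrite ler_pdivrMr -?natrM ?ler_nat ?ltr0n; last by lia.
exact: num_exact_lower_bound.
Qed.
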